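(* Let $\Psi$ be a context of parameters with positive types and let $N_1,N_2$ be simple linear patterns without shared existential variables such that $\Psi\vdash N_1\Uparrow A$ and $\Psi\vdash N_2\Uparrow A$. Then for every closed $M$: ($\Psi\vdash M\in\|N_1\|:A$ and $\Psi\vdash M\in\|N_2\|:A$) if and only if $\Psi\vdash M\in\|N_1\cap N_2\|:A$.
   Context: Strict $\lambda$-calculus over a signature $\Sigma$: labels $k\in\{1,0,u\}$; types $A::=a\mid A_1\to^kA_2$; terms $c\mid x\mid\lambda x^k{:}A.M\mid M_1M_2^k$. Contexts have distinct variables; commas denote disjoint unions. Typing $\Gamma;\Omega;\Delta\vdash M:A$: if $c{:}A\in\Sigma$ then $\Gamma;\Omega;\cdot\vdash c:A$; $(\Gamma,x{:}A);\Omega;\cdot\vdash x:A$; $\Gamma;\Omega;x{:}A\vdash x:A$ (no rule for $\Omega$); $\lambda x^u$, $\lambda x^0$, $\lambda x^1$ typed at $A\to^uB$, $A\to^0B$, $A\to^1B$ from the body typed with $x{:}A$ added to $\Gamma$, $\Omega$, $\Delta$ respectively; from $\Gamma;\Omega;\Delta\vdash M:A\to^uB$ and $(\Gamma,\Delta);\Omega;\cdot\vdash N:A$ infer $\Gamma;\Omega;\Delta\vdash MN^u:B$; from $\Gamma;\Omega;\Delta\vdash M:A\to^0B$ and $(\Gamma,\Omega,\Delta);\cdot;\cdot\vdash N:A$ infer $\Gamma;\Omega;\Delta\vdash MN^0:B$; from $(\Gamma,\Delta_N);\Omega;\Delta_M\vdash M:A\to^1B$ and $(\Gamma,\Delta_M);\Omega;\Delta_N\vdash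 N:A$ infer $\Gamma;\Omega;(\Delta_M,\Delta_N)\vdash MN^1:B$. Simple patterns: positive types $P::=a\mid N\to^1P$, negative $N::=a\mid P\to^uN$; $\Sigma$ and $\Psi$ declare positive types; existential variables form a separate class. For $\Psi=x_1{:}A_1,\dots,x_n{:}A_n$ (fixed order) a label sequence is $\Phi=x_1^{k_1}\dots x_n^{k_n}$, $\Phi(x_i)=k_i$. $\Gamma;\Omega;\Delta\vdash\Phi\ ok$ means $\Gamma,\Omega,\Delta$ partition $\Psi$ with $x$ in $\Gamma$/$\Omega$/$\Delta$ iff $\Phi(x)=u/0/1$. Generalized variable over $\Psi$: $E\,\Phi$ of atomic type $a$, $E{:}A_1\to^{k_1}\cdots A_n\to^{k_n}a$. $\Psi\vdash M\Uparrow A$: $\lambda x^u{:}P.M\Uparrow P\to^uB$ if $(\Psi,x{:}P)\vdash M\Uparrow B$; $h\,M_1^1\dots M_n^1\Uparrow a$ if $h\in\mathrm{dom}(\Sigma\cup\Psi)$ has type $A_1\to^1\cdots\to^1A_n\to^1a$ and $M_i\Uparrow A_i$; $E\,\Phi\Uparrow a$ for generalized variables over $\Psi$. Linear: no existential variable twice; closed: none. Convention: fresh $H\,\Phi$ at non-atomic type $B_1\to^u\cdots\to^uB_m\to^ua$ means $\lambda y_1^u{:}B_1\dots\lambda y_m^u{:}B_m.H\,\Phi\,y_1^u\dots y_m^u$ (with the $y$'s labelled $u$). Ground instances $\Psi\vdash M\in\|N\|:A$ for closed $M$: if $\Gamma;\Omega;\Delta\vdash\Phi\ ok$ and $\Gamma;\Omega;\Delta\vdash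 M:a$ then $M\in\|E\,\Phi\|:a$; if $(\Psi,x{:}A)\vdash M\in\|N\|:B$ then $\lambda x^u{:}A.M\in\|\lambda x^u{:}A.N\|:A\to^uB$; if $h{:}A_1\to^1\cdots\to^1A_n\to^1a$ in $\Sigma\cup\Psi$ and $M_i\in\|N_i\|:A_i$ then $h\,M_1^1\dots M_n^1\in\|h\,N_1^1\dots N_n^1\|:a$. For a set, membership in some element. Intersection. Label intersection: $1\cap1=u\cap1=1\cap u=1$, $0\cap0=u\cap0=0\cap u=0$, $u\cap u=u$, $0\cap1$, $1\cap0$ undefined; extended pointwise to label sequences over the same variables. $\Psi\vdash M\cap N\Rightarrow Q:A$ is defined by ($H$'s fresh existential variables): (FF) $\Psi\vdash(E_1\Phi_1)\cap(E_2\Phi_2)\Rightarrow H\,(\Phi_1\cap\Phi_2):a$ when $\Phi_1\cap\Phi_2$ is defined; (FR$^c$) if $c\in\mathrm{dom}(\Sigma)$, $c{:}A_1\to^1\cdots\to^1A_n\to^1a$, and $\Psi\vdash(H_i\Phi_i)\cap M_i\Rightarrow N_i:A_i$ for all $i$, then $\Psi\vdash(E\,\Phi)\cap(c\,M_1^1\dots M_n^1)\Rightarrow c\,N_1^1\dots N_n^1:a$, provided: $\Phi(x)=0\Rightarrow$ all $\Phi_i(x)=0$; $\Phi(x)=u\Rightarrow$ all $\Phi_i(x)=u$; $\Phi(x)=1\Rightarrow$ exactly one $i$ has $\Phi_i(x)=1$ and $\Phi_j(x)=u$ for $j\ne i$; (FR$^y$) same with a variable $y\in\mathrm{dom}(\Psi)$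 as head, with the same proviso for $x\ne y$, the $0$ and $u$ clauses for all $x$, and $\Phi(y)=1\Rightarrow$ all $\Phi_i(y)=u$; (RF$^c$), (RF$^y$) the symmetric rules with the flexible pattern on the right; (RR) if $h\in\mathrm{dom}(\Psi\cup\Sigma)$ and $\Psi\vdash M_i\cap N_i\Rightarrow Q_i:A_i$ for all $i$ then $\Psi\vdash(h\,M_1^1\dots M_n^1)\cap(h\,N_1^1\dots N_n^1)\Rightarrow h\,Q_1^1\dots Q_n^1:a$; (L) if $(\Psi,x{:}A)\vdash M\cap N\Rightarrow Q:B$ then $\Psi\vdash(\lambda x^u{:}A.M)\cap(\lambda x^u{:}A.N)\Rightarrow\lambda x^u{:}A.Q:A\to^uB$. No rule applies to two occurrences of the same existential variable. $N_1\cap N_2$ denotes the set of all $Q$ with $\Psi\vdash N_1\cap N_2\Rightarrow Q:A$.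
   Formalization: The rules FR^y and RF^y carry the extra proviso Φ(y) ≠ 0; without it E y^0 ∩ y ⇒ y is derivable over Ψ = y:a, although y is not a ground instance of E y^0, so the claim fails as stated. *)

(* Defs.v *)
From Stdlib Require Import List.
Import ListNotations.

Set Implicit Arguments.

(* Terms are in de Bruijn style, so that alpha-equivalence is equality: a
   context lists the innermost declaration first, [Var i] is its i-th entry,
   and "Psi, x:A" is [A :: Psi]. *)

Inductive label := l1 | l0 | lu.

Inductive ty (atom : Type) :=
| Atom (a : atom)
| Arr (A : ty atom) (k : label) (B : ty atom).

Fixpoint pos {atom} (A : ty atom) : Prop :=
  match A with
  | Atom _ => True
  | Arr A l1 B => neg A /\ pos B
  | Arr _ _ _ => False
  end
with neg {atom} (A : ty atom) : Prop :=
  match A with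
  | Atom _ => True
  | Arr A lu B => pos A /\ neg B
  | Arr _ _ _ => False
  end.

(* Existential variables carry their type, so there are infinitely many of
   each type. *)
Record evar (atom : Type) := Evar { ename : nat; ety : ty atom }.

Inductive tm (atom const : Type) :=
| Const (c : const)
| Var (x : nat)
| EVar (E : evar atom)
| Lam (k : label) (A : ty atom) (M : tm atom const)
| App (M : tm atom const) (k : label) (N : tm atom const).
Arguments Const {atom const}.
Arguments Var {atom const}.
Arguments EVar {atom const}.
Arguments Lam {atom const}.
Arguments App {atom const}.

Definition signature (atom const : Type) := const -> option (ty atom).
Definition ctx (atom : Type) := list (ty atom).
Definition lseq := list label.

Definition pos_signature {atom const} (Sg : signature atom const) : Prop :=
  forall c A, Sg c = Some A -> pos A.

Fixpoint evars {atom const} (M : tm atom const) : list (evar atom) :=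
  match M with
  | Const _ | Var _ => []
  | EVar E => [E]
  | Lam _ _ M => evars M
  | App M _ N => evars M ++ evars N
  end.

Definition linear {atom const} (M : tm atom const) : Prop := NoDup (evars M).
Definition closed {atom const} (M : tm atom const) : Prop := evars M = [].

(* The three zones Gamma; Omega; Delta are kept in a single list in which each
   declaration carries the label of its zone: lu for Gamma, l0 for Omega, l1
   for Delta. *)
Definition zctx (atom : Type) := list (ty atom * label).

Definition no_strict {atom} (Z : zctx atom) : Prop :=
  forall x A, nth_error Z x <> Some (A, l1).

(* (Gamma, Delta); Omega; . *)
Definition unstrict {atom} (Z : zctx atom) : zctx atom :=
  map (fun d => (fst d, match snd d with l1 => lu | k => k end)) Z.

(* (Gamma, Omega, Delta); .; . *)
Definition unrestrict {atom} (Z : zctx atom) : zctx atom :=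
  map (fun d => (fst d, lu)) Z.

(* [zsplit Z ZM ZN]: if Z is Gamma; Omega; (Delta_M, Delta_N), then
   ZM is (Gamma, Delta_N); Omega; Delta_M and
   ZN is (Gamma, Delta_M); Omega; Delta_N. *)
Inductive zsplit {atom} : zctx atom -> zctx atom -> zctx atom -> Prop :=
| zs_nil : zsplit [] [] []
| zs_u A Z ZM ZN : zsplit Z ZM ZN ->
    zsplit ((A, lu) :: Z) ((A, lu) :: ZM) ((A, lu) :: ZN)
| zs_0 A Z ZM ZN : zsplit Z ZM ZN ->
    zsplit ((A, l0) :: Z) ((A, l0) :: ZM) ((A, l0) :: ZN)
| zs_1M A Z ZM ZN : zsplit Z ZM ZN ->
    zsplit ((A, l1) :: Z) ((A, l1) :: ZM) ((A, lu) :: ZN)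
| zs_1N A Z ZM ZN : zsplit Z ZM ZN ->
    zsplit ((A, l1) :: Z) ((A, lu) :: ZM) ((A, l1) :: ZN).

Inductive typing {atom const} (Sg : signature atom const) :
    zctx atom -> tm atom const -> ty atom -> Prop :=
| t_const Z c A :
    Sg c = Some A -> no_strict Z -> typing Sg Z (Const c) A
| t_var_u Z x A :
    nth_error Z x = Some (A, lu) -> no_strict Z -> typing Sg Z (Var x) A
| t_var_1 Z x A :
    nth_error Z x = Some (A, l1) ->
    (forall y B, nth_error Z y = Some (B, l1) -> y = x) ->
    typing Sg Z (Var x) A
| t_lam Z k A M B :
    typing Sg ((A, k) :: Z) M B -> typing Sg Z (Lam k A M) (Arr A k B)
| t_app_u Z M N A B :
    typing Sg Z M (Arr A lu B) -> typing Sg (unstrict Z) N A ->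
    typing Sg Z (App M lu N) B
| t_app_0 Z M N A B :
    typing Sg Z M (Arr A l0 B) -> typing Sg (unrestrict Z) N A ->
    typing Sg Z (App M l0 N) B
| t_app_1 Z ZM ZN M N A B :
    zsplit Z ZM ZN -> typing Sg ZM M (Arr A l1 B) -> typing Sg ZN N A ->
    typing Sg Z (App M l1 N) B.

Definition ok {atom} (Z : zctx atom) (Psi : ctx atom) (Phi : lseq) : Prop :=
  map fst Z = Psi /\ map snd Z = Phi.

(* A_1 ->^{k_1} ... A_n ->^{k_n} B for the context Psi = x_1:A_1, ..., x_n:A_n
   (listed from x_n to x_1) and Phi = x_1^{k_1} ... x_n^{k_n}. *)
Fixpoint arrs {atom} (Psi : ctx atom) (Phi : lseq) (B : ty atom) : ty atom :=
  match Psi, Phi with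
  | A :: Psi, k :: Phi => arrs Psi Phi (Arr A k B)
  | _, _ => B
  end.

(* E x_1^{k_1} ... x_n^{k_n}, where x_n is [Var i], x_(n-1) is [Var (S i)],
   etc. *)
Fixpoint eapp_from {atom const} (i : nat) (E : evar atom) (Phi : lseq)
    : tm atom const :=
  match Phi with
  | [] => EVar E
  | k :: Phi => App (eapp_from (S i) E Phi) k (Var i)
  end.

Definition eapp {atom const} (E : evar atom) (Phi : lseq) : tm atom const :=
  eapp_from 0 E Phi.

(* [E Phi] is well formed over Psi and has type A; it is a generalized variable
   when A is atomic. *)
Definition gvar {atom} (Psi : ctx atom) (E : evar atom) (Phi : lseq)
    (A : ty atom) : Prop :=
  length Phi = length Psi /\ ety E = arrs Psi Phi A.

(* The convention for H Phi at type B_1 ->^u ... B_m ->^u a: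
   lambda y_1^u:B_1 ... lambda y_m^u:B_m. H Phi y_1^u ... y_m^u. *)
Fixpoint eta_eapp {atom const} (H : evar atom) (Phi : lseq) (A : ty atom)
    : tm atom const :=
  match A with
  | Atom _ => eapp H Phi
  | Arr B _ C => Lam lu B (eta_eapp H (lu :: Phi) C)
  end.

(* A_1 ->^1 ... A_n ->^1 a *)
Definition arr1 {atom} (As : list (ty atom)) (a : atom) : ty atom :=
  fold_right (fun A B => Arr A l1 B) (Atom a) As.

(* h M_1^1 ... M_n^1 *)
Definition app1 {atom const} (h : tm atom const) (Ms : list (tm atom const))
    : tm atom const :=
  fold_left (fun h M => App h l1 M) Ms h.

Inductive is_head {atom const} (Sg : signature atom const) (Psi : ctx atom) :
    tm atom const -> ty atom -> Prop :=
| head_const c A : Sg c = Some A -> is_head Sg Psi (Const c) A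
| head_var x A : nth_error Psi x = Some A -> is_head Sg Psi (Var x) A.

Inductive pat {atom const} (Sg : signature atom const) :
    ctx atom -> tm atom const -> ty atom -> Prop :=
| pat_lam Psi P M B :
    pos P -> pat Sg (P :: Psi) M B -> pat Sg Psi (Lam lu P M) (Arr P lu B)
| pat_rigid Psi h As a Ms :
    is_head Sg Psi h (arr1 As a) -> pats Sg Psi Ms As ->
    pat Sg Psi (app1 h Ms) (Atom a)
| pat_flex Psi E Phi a :
    gvar Psi E Phi (Atom a) -> pat Sg Psi (eapp E Phi) (Atom a)
with pats {atom const} (Sg : signature atom const) :
    ctx atom -> list (tm atom const) -> list (ty atom) -> Prop :=
| pats_nil Psi : pats Sg Psi [] []
| pats_cons Psi M Ms A As :
    pat Sg Psi M A -> pats Sg Psi Ms As -> pats Sg Psi (M :: Ms) (A :: As).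

(* [ground Sg Psi M N A] is Psi |- M in ||N|| : A. *)
Inductive ground {atom const} (Sg : signature atom const) :
    ctx atom -> tm atom const -> tm atom const -> ty atom -> Prop :=
| ground_flex Psi Z M E Phi a :
    gvar Psi E Phi (Atom a) -> ok Z Psi Phi -> typing Sg Z M (Atom a) ->
    ground Sg Psi M (eapp E Phi) (Atom a)
| ground_lam Psi A B M N :
    ground Sg (A :: Psi) M N B ->
    ground Sg Psi (Lam lu A M) (Lam lu A N) (Arr A lu B)
| ground_rigid Psi h As a Ms Ns :
    is_head Sg Psi h (arr1 As a) -> grounds Sg Psi Ms Ns As ->
    ground Sg Psi (app1 h Ms) (app1 h Ns) (Atom a)
with grounds {atom const} (Sg : signature atom const) :
    ctx atom -> list (tm atom const) -> list (tm atom const) ->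
    list (ty atom) -> Prop :=
| grounds_nil Psi : grounds Sg Psi [] [] []
| grounds_cons Psi M Ms N Ns A As :
    ground Sg Psi M N A -> grounds Sg Psi Ms Ns As ->
    grounds Sg Psi (M :: Ms) (N :: Ns) (A :: As).

Definition ground_set {atom const} (Sg : signature atom const) (Psi : ctx atom)
    (M : tm atom const) (Qs : tm atom const -> Prop) (A : ty atom) : Prop :=
  exists Q, Qs Q /\ ground Sg Psi M Q A.

Definition cap_label (k1 k2 : label) : option label :=
  match k1, k2 with
  | l1, l1 | lu, l1 | l1, lu => Some l1
  | l0, l0 | lu, l0 | l0, lu => Some l0
  | lu, lu => Some lu
  | l0, l1 | l1, l0 => None
  end.

(* [cap_lseq Phi1 Phi2 Phi]: the pointwise intersection is defined and equals
   Phi. *)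
Definition cap_lseq (Phi1 Phi2 Phi : lseq) : Prop :=
  length Phi1 = length Phi /\ length Phi2 = length Phi /\
  forall x k1 k2, nth_error Phi1 x = Some k1 -> nth_error Phi2 x = Some k2 ->
    cap_label k1 k2 = nth_error Phi x.

Definition all_label (Phis : list lseq) (x : nat) (k : label) : Prop :=
  forall i Phi_i, nth_error Phis i = Some Phi_i -> nth_error Phi_i x = Some k.

Definition one_strict (Phis : list lseq) (x : nat) : Prop :=
  exists i Phi_i,
    nth_error Phis i = Some Phi_i /\ nth_error Phi_i x = Some l1 /\
    forall j Phi_j, j <> i -> nth_error Phis j = Some Phi_j ->
      nth_error Phi_j x = Some lu.

Definition proviso_const (Phi : lseq) (Phis : list lseq) : Prop :=
  forall x,
    (nth_error Phi x = Some l0 -> all_label Phis x l0) /\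
    (nth_error Phi x = Some lu -> all_label Phis x lu) /\
    (nth_error Phi x = Some l1 -> one_strict Phis x).

(* The rules with a variable head y are meant for Phi(y) <> 0 (first conjunct):
   no term headed by y is an instance of E Phi when Phi(y) = 0.  Without this,
   E y^0 cap y => y would be derivable in the context y:a. *)
Definition proviso_var (y : nat) (Phi : lseq) (Phis : list lseq) : Prop :=
  nth_error Phi y <> Some l0 /\
  (nth_error Phi y = Some l1 -> all_label Phis y lu) /\
  forall x,
    (nth_error Phi x = Some l0 -> all_label Phis x l0) /\
    (nth_error Phi x = Some lu -> all_label Phis x lu) /\
    (x <> y -> nth_error Phi x = Some l1 -> one_strict Phis x).

(* [flex_args Psi Hs Phis As Us]: Us lists the eta-expanded H_i Phi_i : A_i. *)
Inductive flex_args {atom const} (Psi : ctx atom) :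
    list (evar atom) -> list lseq -> list (ty atom) ->
    list (tm atom const) -> Prop :=
| flex_nil : flex_args Psi [] [] [] []
| flex_cons H Phi A Hs Phis As Us :
    gvar Psi H Phi A -> flex_args Psi Hs Phis As Us ->
    flex_args Psi (H :: Hs) (Phi :: Phis) (A :: As) (eta_eapp H Phi A :: Us).

(* [inter Sg Psi M N Q A F] is Psi |- M cap N => Q : A, where F lists the
   existential variables H introduced by the derivation.  That they are fresh
   is a condition on the whole derivation, imposed in [cap] below. *)
Inductive inter {atom const} (Sg : signature atom const) :
    ctx atom -> tm atom const -> tm atom const -> tm atom const -> ty atom ->
    list (evar atom) -> Prop :=
| inter_FF Psi E1 Phi1 E2 Phi2 H Phi a :
    E1 <> E2 -> gvar Psi E1 Phi1 (Atom a) -> gvar Psi E2 Phi2 (Atom a) ->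
    cap_lseq Phi1 Phi2 Phi -> gvar Psi H Phi (Atom a) ->
    inter Sg Psi (eapp E1 Phi1) (eapp E2 Phi2) (eapp H Phi) (Atom a) [H]
| inter_FRc Psi E Phi c As a Hs Phis Us Ms Ns F :
    gvar Psi E Phi (Atom a) -> Sg c = Some (arr1 As a) ->
    flex_args Psi Hs Phis As Us -> proviso_const Phi Phis ->
    inters Sg Psi Us Ms Ns As F ->
    inter Sg Psi (eapp E Phi) (app1 (Const c) Ms) (app1 (Const c) Ns) (Atom a)
      (Hs ++ F)
| inter_FRy Psi E Phi y As a Hs Phis Us Ms Ns F :
    gvar Psi E Phi (Atom a) -> nth_error Psi y = Some (arr1 As a) ->
    flex_args Psi Hs Phis As Us -> proviso_var y Phi Phis ->
    inters Sg Psi Us Ms Ns As F ->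
    inter Sg Psi (eapp E Phi) (app1 (Var y) Ms) (app1 (Var y) Ns) (Atom a)
      (Hs ++ F)
| inter_RFc Psi E Phi c As a Hs Phis Us Ms Ns F :
    gvar Psi E Phi (Atom a) -> Sg c = Some (arr1 As a) ->
    flex_args Psi Hs Phis As Us -> proviso_const Phi Phis ->
    inters Sg Psi Ms Us Ns As F ->
    inter Sg Psi (app1 (Const c) Ms) (eapp E Phi) (app1 (Const c) Ns) (Atom a)
      (Hs ++ F)
| inter_RFy Psi E Phi y As a Hs Phis Us Ms Ns F :
    gvar Psi E Phi (Atom a) -> nth_error Psi y = Some (arr1 As a) ->
    flex_args Psi Hs Phis As Us -> proviso_var y Phi Phis ->
    inters Sg Psi Ms Us Ns As F ->
    inter Sg Psi (app1 (Var y) Ms) (eapp E Phi) (app1 (Var y) Ns) (Atom a)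
      (Hs ++ F)
| inter_RR Psi h As a Ms Ns Qs F :
    is_head Sg Psi h (arr1 As a) -> inters Sg Psi Ms Ns Qs As F ->
    inter Sg Psi (app1 h Ms) (app1 h Ns) (app1 h Qs) (Atom a) F
| inter_L Psi A B M N Q F :
    inter Sg (A :: Psi) M N Q B F ->
    inter Sg Psi (Lam lu A M) (Lam lu A N) (Lam lu A Q) (Arr A lu B) F
with inters {atom const} (Sg : signature atom const) :
    ctx atom -> list (tm atom const) -> list (tm atom const) ->
    list (tm atom const) -> list (ty atom) -> list (evar atom) -> Prop :=
| inters_nil Psi : inters Sg Psi [] [] [] [] []
| inters_cons Psi M Ms N Ns Q Qs A As F Fs :
    inter Sg Psi M N Q A F -> inters Sg Psi Ms Ns Qs As Fs ->
    inters Sg Psi (M :: Ms) (N :: Ns) (Q :: Qs) (A :: As) (F ++ Fs).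

(* The set N1 cap N2. *)
Definition cap {atom const} (Sg : signature atom const) (Psi : ctx atom)
    (N1 N2 : tm atom const) (A : ty atom) (Q : tm atom const) : Prop :=
  exists F, inter Sg Psi N1 N2 Q A F /\ NoDup F /\
    forall H, In H F -> ~ In H (evars N1) /\ ~ In H (evars N2).

(* Main.v *)
Require Import Defs.
From Stdlib Require Import List Lia PeanoNat Wf_nat.
Import ListNotations.

(** Typing with zones splits into simple typing (with local label conditions at
    each abstraction) and one independent condition per variable: a variable
    labelled [0] occurs only inside arguments of [0]-applications, and one
    labelled [1] has an occurrence that lies in no argument of a [0]- or
    [u]-application.  The two conditions exclude each other, so the instances of
    [E1 Phi1] and [E2 Phi2] have as common instances exactly those of
    [H (Phi1 cap Phi2)].  For a term [h M_1 ... M_n] each strict variable is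
    strict in the head or in some [M_i]; choosing such an [i] for every variable
    yields the label sequences [Phi_i] of the flexible-rigid rules.
    Completeness of intersection then goes by induction on the size of the ground
    term, drawing new existential variables with names above a running bound. *)

(** * Label conditions on the occurrences of a variable *)

Fixpoint strict {atom const} (x : nat) (M : tm atom const) : Prop :=
  match M with
  | Const _ | EVar _ => False
  | Var y => x = y
  | Lam _ _ M => strict (S x) M
  | App M l1 N => strict x M \/ strict x N
  | App M _ _ => strict x M
  end.

Fixpoint irrelevant {atom const} (x : nat) (M : tm atom const) : Prop :=
  match M with
  | Const _ | EVar _ => True
  | Var y => x <> y
  | Lam _ _ M => irrelevant (S x) M
  | App M l0 _ => irrelevant x M
  | App M _ N => irrelevant x M /\ irrelevant x N
  end.

Definition respects {atom const} (k : label) (x : nat) (M : tm atom const) : Prop :=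
  match k with l1 => strict x M | l0 => irrelevant x M | lu => True end.

Definition respects_seq {atom const} (Phi : lseq) (M : tm atom const) : Prop :=
  forall x k, nth_error Phi x = Some k -> respects k x M.

(** Typing with the zones erased: function and argument share one context, whatever the label of the
    application. Labels of free variables are left to [respects_seq]; only the condition on the
    bound variable of each abstraction is kept here. Existential variables get no type, so only
    closed terms satisfy [wt]. *)
Fixpoint wt {atom const} (Sg : signature atom const) (Psi : ctx atom)
    (M : tm atom const) (T : ty atom) : Prop :=
  match M with
  | Const c => Sg c = Some T
  | Var x => nth_error Psi x = Some T
  | EVar _ => False
  | Lam k A M => exists B, T = Arr A k B /\ wt Sg (A :: Psi) M B /\ respects k 0 M
  | App M k N => exists A, wt Sg Psi M (Arr A k T) /\ wt Sg Psi N A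
  end.

(** A strict occurrence lies outside every argument of a [l0]-application, whereas an irrelevant
    variable may occur only inside such arguments. *)
Lemma strict_not_irrelevant {atom const} (M : tm atom const) :
  forall x, strict x M -> irrelevant x M -> False.
Proof.
  induction M as [c|y|E|k A M IH|M IHM k N IHN]; simpl; intros x; eauto.
  destruct k; simpl; intuition eauto.
Qed.

(** Both conditions pass through an abstraction by shifting the index, so position 0 concerns the
    bound variable and the rest the abstraction itself. The annotation [k'] is arbitrary because
    [strict] and [irrelevant] do not inspect it. *)
Lemma respects_seq_lam {atom const} k Phi k' A (M : tm atom const) :
  respects_seq (k :: Phi) M <-> respects_seq Phi (Lam k' A M) /\ respects k 0 M.
Proof.
  split.
  - intros H; split.
    + intros x j Hx. specialize (H (S x) j Hx). destruct j; exact H.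
    + exact (H 0 k eq_refl).
  - intros [H H0] [|x] j Hx; simpl in Hx.
    + injection Hx as <-. exact H0.
    + specialize (H x j Hx). destruct j; exact H.
Qed.

(** * Typing as simple typing plus label conditions *)

Lemma nth_error_map_snd {A B} (Z : list (A * B)) x k :
  nth_error (map snd Z) x = Some k <-> exists T, nth_error Z x = Some (T, k).
Proof.
  rewrite nth_error_map. destruct (nth_error Z x) as [[T j]|]; simpl.
  - split; [intros [= <-]; eauto | intros [T' [= -> ->]]; reflexivity].
  - split; [discriminate | intros [T' [=]]].
Qed.

Lemma map_fst_unstrict {atom} (Z : zctx atom) : map fst (unstrict Z) = map fst Z.
Proof. unfold unstrict. rewrite map_map. apply map_ext. reflexivity. Qed.

Lemma map_fst_unrestrict {atom} (Z : zctx atom) :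
  map fst (unrestrict Z) = map fst Z.
Proof. unfold unrestrict. rewrite map_map. apply map_ext. reflexivity. Qed.

Lemma nth_error_snd_unstrict {atom} (Z : zctx atom) x :
  nth_error (map snd (unstrict Z)) x =
  option_map (fun k => match k with l1 => lu | k => k end) (nth_error (map snd Z) x).
Proof.
  unfold unstrict. rewrite map_map, !nth_error_map.
  destruct (nth_error Z x) as [[A []]|]; reflexivity.
Qed.

Lemma nth_error_snd_unrestrict {atom} (Z : zctx atom) x :
  nth_error (map snd (unrestrict Z)) x =
  option_map (fun _ => lu) (nth_error (map snd Z) x).
Proof.
  unfold unrestrict. rewrite map_map, !nth_error_map.
  destruct (nth_error Z x); reflexivity.
Qed.

Lemma zsplit_map_fst {atom} (Z ZM ZN : zctx atom) :
  zsplit Z ZM ZN -> map fst ZM = map fst Z /\ map fst ZN = map fst Z.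
Proof. induction 1; simpl; intuition congruence. Qed.

Lemma zsplit_nth {atom} (Z ZM ZN : zctx atom) :
  zsplit Z ZM ZN -> forall x k, nth_error (map snd Z) x = Some k ->
  match k with
  | l1 => nth_error (map snd ZM) x = Some l1 \/ nth_error (map snd ZN) x = Some l1
  | k => nth_error (map snd ZM) x = Some k /\ nth_error (map snd ZN) x = Some k
  end.
Proof.
  induction 1; intros [|x] k Hx; simpl in *; try discriminate;
    try (injection Hx as <-; auto; fail); apply IHzsplit; exact Hx.
Qed.

(** [P] and [Q] stand for strictness in the function and in the argument. Each strict declaration
    goes to a side where it is known to hold and becomes [lu] on the other, where it demands
    nothing; label [l0] arises on a side only from [l0] in [Z]. *)
Lemma zsplit_exists {atom} (Z : zctx atom) : forall (P Q : nat -> Prop),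
  (forall x, nth_error (map snd Z) x = Some l1 -> P x \/ Q x) ->
  exists ZM ZN, zsplit Z ZM ZN /\
    (forall x, nth_error (map snd ZM) x = Some l1 -> P x) /\
    (forall x, nth_error (map snd ZN) x = Some l1 -> Q x) /\
    (forall x, nth_error (map snd ZM) x = Some l0 ->
       nth_error (map snd Z) x = Some l0) /\
    (forall x, nth_error (map snd ZN) x = Some l0 ->
       nth_error (map snd Z) x = Some l0).
Proof.
  induction Z as [|[A k] Z IH]; intros P Q H.
  - exists [], []. repeat split; [constructor|..]; intros [|x]; discriminate.
  - destruct (IH (fun x => P (S x)) (fun x => Q (S x))) as (ZM & ZN & HZ & HP & HQ & HM & HN).
    { intros x Hx. exact (H (S x) Hx). }
    destruct k; [destruct (H 0 eq_refl)|..].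
    + exists ((A, l1) :: ZM), ((A, lu) :: ZN).
      split; [constructor; exact HZ|].
      repeat split; intros [|x] Hx; simpl in *; try discriminate; auto.
    + exists ((A, lu) :: ZM), ((A, l1) :: ZN).
      split; [constructor; exact HZ|].
      repeat split; intros [|x] Hx; simpl in *; try discriminate; auto.
    + exists ((A, l0) :: ZM), ((A, l0) :: ZN).
      split; [constructor; exact HZ|].
      repeat split; intros [|x] Hx; simpl in *; try discriminate; auto.
    + exists ((A, lu) :: ZM), ((A, lu) :: ZN).
      split; [constructor; exact HZ|].
      repeat split; intros [|x] Hx; simpl in *; try discriminate; auto.
Qed.

(** Each zone operation of an application rule matches a clause of [strict] or [irrelevant]:
    [unstrict] keeps [l0] for the argument, [unrestrict] forgets every label there, and [zsplit]
    leaves each strict variable strict on exactly one side. *)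
Lemma typing_wt {atom const} (Sg : signature atom const) Z M A :
  typing Sg Z M A -> wt Sg (map fst Z) M A /\ respects_seq (map snd Z) M.
Proof.
  induction 1 as [Z c A Hc Hns|Z x A Hx Hns|Z x A Hx Hu|Z k A M B _ IH
    |Z M N A B _ [IHM LM] _ [IHN LN]|Z M N A B _ [IHM LM] _ [IHN LN]
    |Z ZM ZN M N A B HZ _ [IHM LM] _ [IHN LN]].
  - split; [exact Hc|]. intros y k Hy. destruct k; simpl; auto.
    apply nth_error_map_snd in Hy as [T Hy]. exact (Hns _ _ Hy).
  - split; [simpl; rewrite nth_error_map, Hx; reflexivity|].
    intros y k Hy. apply nth_error_map_snd in Hy as [T Hy]. destruct k; simpl; auto.
    + destruct (Hns _ _ Hy).
    + intros ->. congruence.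
  - split; [simpl; rewrite nth_error_map, Hx; reflexivity|].
    intros y k Hy. apply nth_error_map_snd in Hy as [T Hy]. destruct k; simpl; eauto.
    intros ->. congruence.
  - simpl in IH. destruct IH as [IH L].
    apply (respects_seq_lam _ _ k A) in L as [L L0].
    split; [|exact L]. simpl. eauto.
  - rewrite map_fst_unstrict in IHN. split; [simpl; eauto|].
    intros x k Hx. specialize (LM x k Hx). destruct k; simpl in *; auto.
    split; auto. apply (LN x l0). rewrite nth_error_snd_unstrict, Hx. reflexivity.
  - rewrite map_fst_unrestrict in IHN. split; [simpl; eauto|].
    intros x k Hx. specialize (LM x k Hx). destruct k; simpl in *; auto.
  - destruct (zsplit_map_fst _ _ _ HZ) as [EM EN]. rewrite EM in IHM. rewrite EN in IHN.
    split; [simpl; eauto|].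
    intros x k Hx. pose proof (zsplit_nth _ _ _ HZ x k Hx) as Hk.
    destruct k; simpl; auto.
    + destruct Hk as [Hk|Hk]; [left; apply (LM x l1 Hk)|right; apply (LN x l1 Hk)].
    + destruct Hk as [H1 H2]. split; [apply (LM x l0 H1)|apply (LN x l0 H2)].
Qed.

(** Structural induction on the term. The zones are forced except at a [l1]-application, where they
    are split according to where each strict variable has a strict occurrence. *)
Lemma wt_typing {atom const} (Sg : signature atom const) M : forall Z A,
  wt Sg (map fst Z) M A -> respects_seq (map snd Z) M -> typing Sg Z M A.
Proof.
  induction M as [c|y|E|k A M IH|M IHM k N IHN]; intros Z T HT L; simpl in HT.
  - apply t_const; [exact HT|]. intros x A Hx.
    apply (L x l1). apply nth_error_map_snd. eauto.
  - rewrite nth_error_map in HT.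
    destruct (nth_error Z y) as [[T' k]|] eqn:Hy; [|discriminate].
    injection HT as ->.
    (* In a variable, being strict means being that variable, so at most [y] can be labelled
       [l1]. *)
    assert (Hstr : forall x B, nth_error Z x = Some (B, l1) -> x = y).
    { intros x B Hx. apply (L x l1). apply nth_error_map_snd. eauto. }
    destruct k.
    + apply t_var_1; assumption.
    (* Label [l0] would make [y] irrelevant in [Var y]. *)
    + exfalso. apply (L y l0); [apply nth_error_map_snd; eauto|reflexivity].
    + apply t_var_u; [exact Hy|]. intros x B Hx. pose proof (Hstr x B Hx). congruence.
  - destruct HT.
  - destruct HT as (B & -> & HB & L0). apply t_lam. apply IH; [exact HB|].
    apply (respects_seq_lam _ _ k A). split; assumption.
  - destruct HT as (A & HM & HN). destruct k.
    + destruct (zsplit_exists Z (fun x => strict x M) (fun x => strict x N))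
        as (ZM & ZN & HZ & HP & HQ & H0M & H0N).
      { intros x Hx. exact (L x l1 Hx). }
      destruct (zsplit_map_fst _ _ _ HZ) as [EM EN].
      apply (t_app_1 HZ (A := A)).
      * apply IHM; [rewrite EM; exact HM|]. intros x k Hx.
        destruct k; simpl; auto. apply (L x l0 (H0M x Hx)).
      * apply IHN; [rewrite EN; exact HN|]. intros x k Hx.
        destruct k; simpl; auto. apply (L x l0 (H0N x Hx)).
    + apply (t_app_0 (A := A)).
      * apply IHM; [exact HM|]. intros x k Hx.
        specialize (L x k Hx). destruct k; exact L.
      * apply IHN; [rewrite map_fst_unrestrict; exact HN|]. intros x k Hx.
        rewrite nth_error_snd_unrestrict in Hx.
        destruct (nth_error (map snd Z) x); [injection Hx as <-; exact I|discriminate].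
    + apply (t_app_u (A := A)).
      * apply IHM; [exact HM|]. intros x k Hx.
        specialize (L x k Hx). destruct k; [exact L|apply L|exact I].
      * apply IHN; [rewrite map_fst_unstrict; exact HN|]. intros x k Hx.
        rewrite nth_error_snd_unstrict in Hx.
        destruct (nth_error (map snd Z) x) as [j|] eqn:Hj; [|discriminate].
        destruct j; injection Hx as <-; simpl; auto. apply (L x l0 Hj).
Qed.

(** * Spines *)

(** [app1] and [eapp] are functions, not constructors, so inversion cannot see through equations
    between them. The projections of a spine recover head, arguments and labels, and thereby give
    injectivity and tell flexible terms from rigid ones. *)
Fixpoint spine_head {atom const} (M : tm atom const) : tm atom const :=
  match M with App M _ _ => spine_head M | M => M end.

Fixpoint spine_args {atom const} (M : tm atom const) : list (tm atom const) :=
  match M with App M _ N => spine_args M ++ [N] | _ => [] end.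

Fixpoint spine_labels {atom const} (M : tm atom const) : list label :=
  match M with App M k _ => k :: spine_labels M | _ => [] end.

Definition rigid_head {atom const} (h : tm atom const) : Prop :=
  match h with Const _ | Var _ => True | _ => False end.

Lemma is_head_rigid {atom const} (Sg : signature atom const) Psi h A :
  is_head Sg Psi h A -> rigid_head h.
Proof. destruct 1; exact I. Qed.

Lemma is_head_wt {atom const} (Sg : signature atom const) Psi h A :
  rigid_head h -> is_head Sg Psi h A <-> wt Sg Psi h A.
Proof.
  intros Hh. split.
  - destruct 1; assumption.
  - destruct h; simpl in *; try contradiction; constructor; assumption.
Qed.

Lemma is_head_fun {atom const} (Sg : signature atom const) Psi h A B :
  is_head Sg Psi h A -> is_head Sg Psi h B -> A = B.
Proof. destruct 1; inversion 1; congruence. Qed.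

Lemma arr1_inj {atom} (As : list (ty atom)) a : forall As' a',
  arr1 As a = arr1 As' a' -> As = As' /\ a = a'.
Proof.
  induction As as [|A As IH]; intros [|A' As'] a'; simpl; try discriminate.
  - intros [=]; auto.
  - intros [= -> H]. apply IH in H as [-> ->]. auto.
Qed.

Lemma spine_head_app1 {atom const} Ms : forall h : tm atom const,
  spine_head (app1 h Ms) = spine_head h.
Proof. induction Ms as [|M Ms IH]; intros h; simpl; [|rewrite IH]; reflexivity. Qed.

Lemma spine_args_app1 {atom const} Ms : forall h : tm atom const,
  spine_args (app1 h Ms) = spine_args h ++ Ms.
Proof.
  induction Ms as [|M Ms IH]; intros h; simpl; [rewrite app_nil_r; reflexivity|].
  rewrite IH. simpl. rewrite <- app_assoc. reflexivity.
Qed.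

Lemma spine_head_eapp_from {atom const} E Phi : forall i,
  spine_head (eapp_from i E Phi : tm atom const) = EVar E.
Proof. induction Phi; intros i; simpl; auto. Qed.

Lemma spine_labels_eapp_from {atom const} E Phi : forall i,
  spine_labels (eapp_from i E Phi : tm atom const) = Phi.
Proof. induction Phi; intros i; simpl; f_equal; auto. Qed.

Lemma app1_inj {atom const} (h h' : tm atom const) Ms Ms' :
  rigid_head h -> rigid_head h' -> app1 h Ms = app1 h' Ms' -> h = h' /\ Ms = Ms'.
Proof.
  intros Hh Hh' E. split.
  - apply (f_equal spine_head) in E. rewrite !spine_head_app1 in E.
    destruct h; destruct Hh; destruct h'; destruct Hh'; exact E.
  - apply (f_equal spine_args) in E. rewrite !spine_args_app1 in E.
    destruct h; destruct Hh; destruct h'; destruct Hh'; exact E.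
Qed.

Lemma eapp_inj {atom const} E E' Phi Phi' :
  eapp E Phi = (eapp E' Phi' : tm atom const) -> E = E' /\ Phi = Phi'.
Proof.
  unfold eapp. intros H. split.
  - apply (f_equal spine_head) in H. rewrite !spine_head_eapp_from in H. congruence.
  - apply (f_equal spine_labels) in H. rewrite !spine_labels_eapp_from in H. exact H.
Qed.

Lemma eapp_not_app1 {atom const} E Phi (h : tm atom const) Ms :
  rigid_head h -> eapp E Phi <> app1 h Ms.
Proof.
  intros Hh H. apply (f_equal spine_head) in H.
  unfold eapp in H. rewrite spine_head_eapp_from, spine_head_app1 in H.
  destruct h; destruct Hh; discriminate.
Qed.

Lemma spine_head_eapp {atom const} E Phi :
  spine_head (eapp E Phi : tm atom const) = EVar E.
Proof. apply spine_head_eapp_from. Qed.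

Lemma evars_app1 {atom const} Ms : forall h : tm atom const,
  evars (app1 h Ms) = evars h ++ flat_map evars Ms.
Proof.
  induction Ms as [|M Ms IH]; intros h; simpl; [rewrite app_nil_r; reflexivity|].
  rewrite IH. simpl. rewrite <- app_assoc. reflexivity.
Qed.

Lemma evars_rigid {atom const} (h : tm atom const) : rigid_head h -> evars h = [].
Proof. destruct h; simpl; tauto. Qed.

Lemma evars_eapp {atom const} E Phi : evars (eapp E Phi : tm atom const) = [E].
Proof.
  unfold eapp. generalize 0.
  induction Phi as [|k Phi IH]; intros i; simpl; [|rewrite IH]; reflexivity.
Qed.

Lemma evars_eta_eapp {atom const} H A : forall Phi,
  evars (eta_eapp H Phi A : tm atom const) = [H].
Proof. induction A; intros Phi; simpl; [apply evars_eapp|auto]. Qed.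

Fixpoint tm_size {atom const} (M : tm atom const) : nat :=
  match M with
  | Lam _ _ M => S (tm_size M)
  | App M _ N => S (tm_size M + tm_size N)
  | _ => 1
  end.

(** Arguments of a spine sit at varying depths, so the later induction is on size. The first
    conjunct carries the bound through the growing head. *)
Lemma tm_size_app1 {atom const} Ms : forall h : tm atom const,
  tm_size h <= tm_size (app1 h Ms) /\
  Forall (fun M => tm_size M < tm_size (app1 h Ms)) Ms.
Proof.
  induction Ms as [|M Ms IH]; intros h; simpl; [auto|].
  destruct (IH (App h l1 M)) as [H1 H2]. simpl in H1.
  split; [lia|]. constructor; [lia|exact H2].
Qed.

Lemma wt_app1 {atom const} (Sg : signature atom const) Psi Ms a : forall h,
  wt Sg Psi (app1 h Ms) (Atom a) <->
  exists As, wt Sg Psi h (arr1 As a) /\ Forall2 (wt Sg Psi) Ms As.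
Proof.
  induction Ms as [|M Ms IH]; intros h; simpl.
  - split.
    + intros H. exists []. auto.
    + intros (As & H & HF). inversion HF; subst. exact H.
  - rewrite IH. simpl. split.
    + intros (As & (A & H1 & H2) & HF). exists (A :: As). auto.
    + intros (As & H & HF). inversion HF; subst. eauto.
Qed.

Lemma strict_app1 {atom const} x Ms : forall h : tm atom const,
  strict x (app1 h Ms) <-> strict x h \/ Exists (strict x) Ms.
Proof.
  induction Ms as [|M Ms IH]; intros h; simpl.
  - rewrite Exists_nil. tauto.
  - rewrite IH, Exists_cons. simpl. tauto.
Qed.

Lemma irrelevant_app1 {atom const} x Ms : forall h : tm atom const,
  irrelevant x (app1 h Ms) <-> irrelevant x h /\ Forall (irrelevant x) Ms.
Proof.
  induction Ms as [|M Ms IH]; intros h; simpl.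
  - intuition.
  - rewrite IH, Forall_cons_iff. simpl. tauto.
Qed.

(** * Ground instances *)

(** [ok] determines the zoned context from [Psi] and [Phi], namely as [combine Psi Phi]; the typing
    premise can thus be traded for simple typing and label conditions. *)
Lemma ground_eapp {atom const} (Sg : signature atom const) Psi M E Phi A :
  ground Sg Psi M (eapp E Phi) A <->
  exists a, A = Atom a /\ gvar Psi E Phi (Atom a) /\
    wt Sg Psi M (Atom a) /\ respects_seq Phi M.
Proof.
  split.
  - intros H. remember (eapp E Phi) as N eqn:EN.
    destruct H as [Psi Z M E' Phi' a Hg [H1 H2] Ht|Psi A B M N _|Psi h As a Ms Ns Hh _].
    + apply eapp_inj in EN as [-> ->]. apply typing_wt in Ht as [H3 H4]. subst.
      exists a. auto.
    + apply (f_equal spine_head) in EN. rewrite spine_head_eapp in EN. discriminate.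
    + symmetry in EN. apply eapp_not_app1 in EN; [destruct EN|].
      eapply is_head_rigid; eassumption.
  - intros (a & -> & Hg & Hw & HL).
    assert (Hl : length Phi = length Psi) by apply Hg.
    assert (H1 : map fst (combine Psi Phi) = Psi).
    { clear -Hl. revert Phi Hl. induction Psi; intros [|k Phi] Hl; simpl in *;
        try discriminate; f_equal; auto. }
    assert (H2 : map snd (combine Psi Phi) = Phi).
    { clear -Hl. revert Phi Hl. induction Psi; intros [|k Phi] Hl; simpl in *;
        try discriminate; f_equal; auto. }
    apply ground_flex with (Z := combine Psi Phi); [exact Hg|split; assumption|].
    apply wt_typing; [rewrite H1|rewrite H2]; assumption.
Qed.

Lemma ground_app1_inv {atom const} (Sg : signature atom const) Psi M h Ns A :
  rigid_head h -> ground Sg Psi M (app1 h Ns) A ->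
  exists As a Ms, A = Atom a /\ M = app1 h Ms /\ is_head Sg Psi h (arr1 As a) /\
    grounds Sg Psi Ms Ns As.
Proof.
  intros Hr H. remember (app1 h Ns) as N eqn:EN.
  destruct H as [Psi Z M E Phi a Hg _ Ht|Psi A B M N _|Psi h' As a Ms Ns' Hh HG].
  - apply eapp_not_app1 in EN; [destruct EN|exact Hr].
  - apply (f_equal spine_head) in EN. rewrite spine_head_app1 in EN.
    destruct h; destruct Hr; discriminate.
  - apply app1_inj in EN as [-> ->]; [|eapply is_head_rigid; eassumption|exact Hr].
    exists As, a, Ms. auto.
Qed.

Lemma ground_lam_inv {atom const} (Sg : signature atom const) Psi M k A N T :
  ground Sg Psi M (Lam k A N) T ->
  exists B M', k = lu /\ T = Arr A lu B /\ M = Lam lu A M' /\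
    ground Sg (A :: Psi) M' N B.
Proof.
  intros H. remember (Lam k A N) as N' eqn:EN.
  destruct H as [Psi Z M E Phi a Hg _ Ht|Psi A' B M N' HG|Psi h' As a Ms Ns' Hh HG].
  - apply (f_equal spine_head) in EN. rewrite spine_head_eapp in EN. discriminate.
  - injection EN as <- <- <-. exists B, M. auto.
  - apply (f_equal spine_head) in EN. rewrite spine_head_app1 in EN.
    apply is_head_rigid in Hh. destruct h'; destruct Hh; discriminate.
Qed.

(** Each eta-expanding abstraction prepends [lu] to [Phi]. This demands nothing of the new variable
    and merely shifts the conditions on the others. *)
Lemma ground_eta_eapp_inv {atom const} (Sg : signature atom const) H A :
  forall Psi Phi M, ground Sg Psi M (eta_eapp H Phi A) A ->
  wt Sg Psi M A /\ respects_seq Phi M.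
Proof.
  induction A as [a|B _ k C IH]; intros Psi Phi M HG; simpl in HG.
  - apply ground_eapp in HG as (a' & [= <-] & _ & H1 & H2). auto.
  - apply ground_lam_inv in HG as (C' & M' & _ & [= -> <-] & -> & HG).
    apply IH in HG as [H1 H2].
    apply (respects_seq_lam _ _ lu B) in H2 as [H2 _].
    split; [|exact H2]. simpl. exists C. auto.
Qed.

(* The second instance only guarantees that [M] is an abstraction wherever the
   eta-long pattern demands one. *)
Lemma ground_eta_eapp {atom const} (Sg : signature atom const) H A :
  forall Psi Phi M N, ground Sg Psi M N A -> gvar Psi H Phi A -> wt Sg Psi M A ->
  respects_seq Phi M -> ground Sg Psi M (eta_eapp H Phi A) A.
Proof.
  induction A as [a|B _ k C IH]; intros Psi Phi M N HG Hv Hw HL; simpl.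
  - apply ground_eapp. exists a. auto.
  - inversion HG as [|Psi' B' C' M' N' HG' e1 e2 e3 [e4 e5 e6]|]; subst.
    apply ground_lam. destruct Hw as (C' & [= <-] & Hw & _).
    eapply IH; [exact HG'| |exact Hw|].
    (* [arrs] moves the innermost declaration into the result type, so the type of [H] is the same
       by computation. *)
    + destruct Hv as [Hl He]. split; [simpl; f_equal; exact Hl|exact He].
    + apply (respects_seq_lam _ _ lu B). split; [exact HL|exact I].
Qed.

(** * Label intersection and distribution of labels over arguments *)

(** An intersection is at least as demanding as either label: each of the two is either equal to it
    or [lu]. *)
Lemma cap_lseq_respects {atom const} Phi1 Phi2 Phi (M : tm atom const) :
  cap_lseq Phi1 Phi2 Phi ->
  respects_seq Phi M -> respects_seq Phi1 M /\ respects_seq Phi2 M.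
Proof.
  intros (L1 & L2 & H) HL.
  assert (key : forall x k1 k2, nth_error Phi1 x = Some k1 -> nth_error Phi2 x = Some k2 ->
     respects k1 x M /\ respects k2 x M).
  { intros x k1 k2 H1 H2. specialize (H x k1 k2 H1 H2).
    destruct (nth_error Phi x) as [k|] eqn:Hk.
    - specialize (HL x k Hk).
      destruct k1, k2; simpl in *; try discriminate; injection H as <-; auto.
    - apply nth_error_None in Hk.
      assert (nth_error Phi1 x = None) by (apply nth_error_None; lia). congruence. }
  split; intros x k Hx.
  - destruct (nth_error Phi2 x) eqn:H2; [destruct (key _ _ _ Hx H2); assumption|].
    apply nth_error_None in H2.
    assert (nth_error Phi1 x = None) by (apply nth_error_None; lia). congruence.
  - destruct (nth_error Phi1 x) eqn:H2; [destruct (key _ _ _ H2 Hx); assumption|].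
    apply nth_error_None in H2.
    assert (nth_error Phi2 x = None) by (apply nth_error_None; lia). congruence.
Qed.

(** Intersection is undefined only for [l0] against [l1], and no term respects both at one
    variable. *)
Lemma cap_label_exists {atom const} k1 k2 x (M : tm atom const) :
  respects k1 x M -> respects k2 x M ->
  exists k, cap_label k1 k2 = Some k /\ respects k x M.
Proof.
  pose proof (strict_not_irrelevant M x).
  destruct k1, k2; simpl; intros; try (exfalso; tauto);
    eexists; (split; [reflexivity|assumption]).
Qed.

Lemma cap_lseq_exists {atom const} (M : tm atom const) : forall (Phi1 Phi2 : lseq),
  length Phi1 = length Phi2 -> respects_seq Phi1 M -> respects_seq Phi2 M ->
  exists Phi, cap_lseq Phi1 Phi2 Phi /\ respects_seq Phi M.
Proof.
  unfold respects_seq, cap_lseq. intros Phi1 Phi2 HL.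
  (* The induction strips declarations off the sequences while [M] stays fixed, so the index is
     generalised by the number [n] already removed. *)
  assert (G : forall n,
    (forall x k, nth_error Phi1 x = Some k -> respects k (n + x) M) ->
    (forall x k, nth_error Phi2 x = Some k -> respects k (n + x) M) ->
    exists Phi, (length Phi1 = length Phi /\ length Phi2 = length Phi /\
      forall x k1 k2, nth_error Phi1 x = Some k1 -> nth_error Phi2 x = Some k2 ->
        cap_label k1 k2 = nth_error Phi x) /\
      forall x k, nth_error Phi x = Some k -> respects k (n + x) M).
  { revert Phi2 HL. induction Phi1 as [|k1 Phi1 IH]; intros [|k2 Phi2] HL n H1 H2;
      try discriminate.
    - exists []. repeat split; intros [|x]; discriminate.
    - destruct (IH Phi2 (f_equal pred HL) (S n)) as (Phi & (L1 & L2 & HC) & HR).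
      { intros x k Hx. rewrite Nat.add_succ_comm. exact (H1 (S x) k Hx). }
      { intros x k Hx. rewrite Nat.add_succ_comm. exact (H2 (S x) k Hx). }
      destruct (cap_label_exists k1 k2 (n + 0) M (H1 0 k1 eq_refl) (H2 0 k2 eq_refl))
        as (k & Hk & HRk).
      exists (k :: Phi). simpl. repeat split; try congruence.
      + intros [|x] j1 j2; simpl; [intros [= <-] [= <-]; exact Hk|apply HC].
      + intros [|x] j; simpl; [intros [= <-]; exact HRk|].
        rewrite <- Nat.add_succ_comm. apply HR. }
  exact (G 0).
Qed.

(** Gathers the side conditions for constant and variable heads, so that both kinds of
    flexible-rigid rule are handled at once. *)
Definition proviso {atom const} (h : tm atom const) (Phi : lseq) (Phis : list lseq)
    : Prop :=
  match h with
  | Const _ => proviso_const Phi Phis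
  | Var y => proviso_var y Phi Phis
  | _ => False
  end.

Lemma Forall2_nth_error_r {A B} (R : A -> B -> Prop) l l' : Forall2 R l l' ->
  forall i b, nth_error l' i = Some b -> exists a, nth_error l i = Some a /\ R a b.
Proof.
  induction 1; intros [|i] c Hi; simpl in *; try discriminate; eauto.
  injection Hi as <-. eauto.
Qed.

Lemma Forall2_nth_error_l {A B} (R : A -> B -> Prop) l l' : Forall2 R l l' ->
  forall i a, nth_error l i = Some a -> exists b, nth_error l' i = Some b /\ R a b.
Proof.
  induction 1; intros [|i] c Hi; simpl in *; try discriminate; eauto.
  injection Hi as <-. eauto.
Qed.

Lemma all_label_irrelevant {atom const} Phis (Ms : list (tm atom const)) x :
  Forall2 respects_seq Phis Ms -> all_label Phis x l0 -> Forall (irrelevant x) Ms.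
Proof.
  intros HF HA. apply Forall_forall. intros M HM.
  apply In_nth_error in HM as [i Hi].
  destruct (Forall2_nth_error_r _ _ _ HF i M Hi) as (Phi & HPhi & HR).
  exact (HR x l0 (HA i Phi HPhi)).
Qed.

Lemma one_strict_Exists {atom const} Phis (Ms : list (tm atom const)) x :
  Forall2 respects_seq Phis Ms -> one_strict Phis x -> Exists (strict x) Ms.
Proof.
  intros HF (i & Phi & HPhi & Hx & _).
  destruct (Forall2_nth_error_l _ _ _ HF i Phi HPhi) as (M & HM & HR).
  apply Exists_exists. exists M.
  split; [eapply nth_error_In; eassumption|exact (HR x l1 Hx)].
Qed.

(** A strict variable is strict in the argument singled out by [one_strict], or is the head itself;
    an irrelevant one is irrelevant in the head and in every argument. *)
Lemma proviso_respects {atom const} (h : tm atom const) Phi Phis Ms :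
  proviso h Phi Phis -> Forall2 respects_seq Phis Ms -> respects_seq Phi (app1 h Ms).
Proof.
  intros HP HF x k Hx. destruct h as [c|y| | |]; simpl in HP; try contradiction.
  - destruct (HP x) as (P0 & _ & P1). destruct k; simpl; auto.
    + apply strict_app1. right. eapply one_strict_Exists; eauto.
    + apply irrelevant_app1. split; [exact I|]. eapply all_label_irrelevant; eauto.
  - destruct HP as (Py & _ & HP). destruct (HP x) as (P0 & _ & P1).
    destruct k; simpl; auto.
    + apply strict_app1. destruct (Nat.eq_dec x y) as [->|n]; [left; reflexivity|].
      right. eapply one_strict_Exists; eauto.
    (* [x = y] would give the head the label [l0], which [proviso_var] forbids. *)
    + apply irrelevant_app1. split; [simpl; congruence|].
      eapply all_label_irrelevant; eauto.
Qed.

(** The counterpart of [zsplit_exists] for bare label sequences, now recording exactly which side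
    received each strict variable. *)
Lemma lseq_split (Phi : lseq) : forall (P Q : nat -> Prop),
  (forall x, nth_error Phi x = Some l1 -> P x \/ Q x) ->
  exists Phi1 Phi2 : lseq, length Phi1 = length Phi /\ length Phi2 = length Phi /\
    forall x,
      match nth_error Phi x with
      | Some l1 =>
          P x /\ nth_error Phi1 x = Some l1 /\ nth_error Phi2 x = Some lu \/
          Q x /\ nth_error Phi1 x = Some lu /\ nth_error Phi2 x = Some l1
      | k => nth_error Phi1 x = k /\ nth_error Phi2 x = k
      end.
Proof.
  induction Phi as [|k Phi IH]; intros P Q H.
  - exists [], []. repeat split; intros x. destruct x; simpl; auto.
  - destruct (IH (fun x => P (S x)) (fun x => Q (S x)) (fun x => H (S x)))
      as (Phi1 & Phi2 & L1 & L2 & HS).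
    destruct k; [destruct (H 0 eq_refl)|..];
      [ exists (l1 :: Phi1), (lu :: Phi2) | exists (lu :: Phi1), (l1 :: Phi2)
      | exists (l0 :: Phi1), (l0 :: Phi2) | exists (lu :: Phi1), (lu :: Phi2) ];
      (repeat split; [simpl; congruence..|]; intros [|x]; [simpl; auto|apply HS]).
Qed.

Lemma all_label_cons (Phi : lseq) Phis x k :
  nth_error Phi x = Some k -> all_label Phis x k -> all_label (Phi :: Phis) x k.
Proof. intros H HA [|i] Phi' Hi; [injection Hi as <-; exact H|exact (HA i Phi' Hi)]. Qed.

Lemma one_strict_here (Phi : lseq) Phis x :
  nth_error Phi x = Some l1 -> all_label Phis x lu -> one_strict (Phi :: Phis) x.
Proof.
  intros H HA. exists 0, Phi. repeat split; [exact H|].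
  intros [|j] Phi' Hj Hn; [congruence|exact (HA j Phi' Hn)].
Qed.

Lemma one_strict_there (Phi : lseq) Phis x :
  nth_error Phi x = Some lu -> one_strict Phis x -> one_strict (Phi :: Phis) x.
Proof.
  intros H (i & Phi' & H1 & H2 & H3). exists (S i), Phi'. repeat split; [exact H1|exact H2|].
  intros [|j] Phi'' Hj Hn; [injection Hn as <-; exact H|].
  apply (H3 j); [congruence|exact Hn].
Qed.

(** Arguments are served one at a time: [Phi1] labels the first one and claims the strict variables
    assigned to it, while [Phi2] takes the place of [Phi] for the remaining ones. *)
Lemma proviso_const_exists {atom const} (Ms : list (tm atom const)) : forall Phi,
  (forall x, nth_error Phi x = Some l0 -> Forall (irrelevant x) Ms) ->
  (forall x, nth_error Phi x = Some l1 -> Exists (strict x) Ms) ->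
  exists Phis, Forall (fun Phi' : lseq => length Phi' = length Phi) Phis /\
    Forall2 respects_seq Phis Ms /\ proviso_const Phi Phis.
Proof.
  induction Ms as [|M Ms IH]; intros Phi H0 H1.
  - exists []. repeat split; auto; intros Hx; [intros [|i]; discriminate..|].
    apply H1 in Hx. inversion Hx.
  - destruct (lseq_split Phi (fun x => strict x M) (fun x => Exists (strict x) Ms))
      as (Phi1 & Phi2 & L1 & L2 & HS).
    { intros x Hx. apply Exists_cons. exact (H1 x Hx). }
    destruct (IH Phi2) as (Phis & HL & HR & HP).
    { intros x Hx. specialize (HS x). specialize (H0 x).
      destruct (nth_error Phi x) as [[]|]; destruct HS; try (exfalso; intuition congruence).
      assert (HF : Forall (irrelevant x) (M :: Ms)) by (apply H0; congruence).
      inversion HF; assumption. }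
    { intros x Hx. specialize (HS x).
      destruct (nth_error Phi x) as [[]|]; destruct HS; intuition congruence. }
    exists (Phi1 :: Phis). repeat split.
    + constructor; [exact L1|]. rewrite <- L2. exact HL.
    + constructor; [|exact HR]. intros x k Hx.
      specialize (HS x). specialize (H0 x).
      destruct (nth_error Phi x) as [[]|].
      * destruct HS as [(A & B & _)|(_ & B & _)]; rewrite B in Hx;
          injection Hx as <-; simpl; auto.
      * destruct HS as [B _]. rewrite B in Hx. injection Hx as <-.
        specialize (H0 eq_refl). inversion H0; assumption.
      * destruct HS as [B _]. rewrite B in Hx. injection Hx as <-. exact I.
      * destruct HS; congruence.
    + intros Hx. specialize (HS x). rewrite Hx in HS. destruct HS as [A B].
      apply all_label_cons; [exact A|]. apply HP. exact B.
    + intros Hx. specialize (HS x). rewrite Hx in HS. destruct HS as [A B].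
      apply all_label_cons; [exact A|]. apply HP. exact B.
    + intros Hx. specialize (HS x). rewrite Hx in HS.
      (* A variable claimed by the first argument is [lu] in [Phi2], hence [lu] in all later
         sequences; otherwise its strict position is found among those. *)
      destruct HS as [(_ & A & B)|(_ & A & B)].
      * apply one_strict_here; [exact A|]. apply HP. exact B.
      * apply one_strict_there; [exact A|]. apply HP. exact B.
Qed.

Lemma proviso_exists {atom const} (h : tm atom const) Phi Ms :
  rigid_head h -> respects_seq Phi (app1 h Ms) ->
  exists Phis, Forall (fun Phi' : lseq => length Phi' = length Phi) Phis /\
    Forall2 respects_seq Phis Ms /\ proviso h Phi Phis.
Proof.
  intros Hh HL.
  assert (H0 : forall x, nth_error Phi x = Some l0 ->
    irrelevant x h /\ Forall (irrelevant x) Ms).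
  { intros x Hx. apply irrelevant_app1. exact (HL x l0 Hx). }
  assert (H1 : forall x, nth_error Phi x = Some l1 ->
    strict x h \/ Exists (strict x) Ms).
  { intros x Hx. apply strict_app1. exact (HL x l1 Hx). }
  destruct h as [c|y| | |]; simpl in Hh; try contradiction; simpl in *.
  - apply proviso_const_exists.
    + intros x Hx. apply H0. exact Hx.
    + intros x Hx. destruct (H1 x Hx) as [[]|]. assumption.
  (* The head plays the role of a first argument claiming only [y]. Thus [Phi2] is [Phi] with a
     label [l1] at [y] weakened to [lu], and the case of a constant head applies to it. *)
  - destruct (lseq_split Phi (fun x => x = y) (fun x => x <> y /\ Exists (strict x) Ms))
      as (Phi1 & Phi2 & L1 & L2 & HS).
    { intros x Hx. destruct (Nat.eq_dec x y); [auto|]. right. split; [assumption|].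
      destruct (H1 x Hx); [contradiction|assumption]. }
    destruct (proviso_const_exists Ms Phi2) as (Phis & HF & HR & HP).
    { intros x Hx. specialize (HS x).
      destruct (nth_error Phi x) as [[]|] eqn:Hk; destruct HS; try (exfalso; intuition congruence).
      apply H0. exact Hk. }
    { intros x Hx. specialize (HS x).
      destruct (nth_error Phi x) as [[]|]; destruct HS; intuition congruence. }
    exists Phis. rewrite <- L2. split; [exact HF|]. split; [exact HR|].
    split; [|split].
    (* Label [l0] at [y] would require [y] to be irrelevant in the head [Var y]. *)
    + intros Hy. destruct (H0 y Hy) as [n _]. apply n. reflexivity.
    + intros Hy. specialize (HS y). rewrite Hy in HS. apply HP.
      destruct HS as [(_ & _ & B)|([n _] & _)]; [exact B|congruence].
    + intros x. specialize (HS x). repeat split; intros.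
      * rewrite H in HS. apply HP. apply HS.
      * rewrite H in HS. apply HP. apply HS.
      * rewrite H2 in HS. apply HP. destruct HS as [(n & _)|(_ & _ & B)]; [congruence|exact B].
Qed.

(** * Soundness of intersection *)

Scheme inter_mind := Minimality for inter Sort Prop
  with inters_mind := Minimality for inters Sort Prop.
Combined Scheme inter_inters_ind from inter_mind, inters_mind.

Lemma grounds_flex_args_inv {atom const} (Sg : signature atom const) Psi Hs Phis As Us :
  flex_args Psi Hs Phis As Us -> forall Ms, grounds Sg Psi Ms Us As ->
  Forall2 (wt Sg Psi) Ms As /\ Forall2 respects_seq Phis Ms.
Proof.
  induction 1 as [|H Phi A Hs Phis As Us Hg HF IH]; intros Ms HG;
    inversion HG; subst; [auto|].
  destruct (IH _ ltac:(eassumption)).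
  destruct (ground_eta_eapp_inv Sg H A Psi Phi M); auto.
Qed.

(** Common core of the four flexible-rigid cases of soundness; the premise on [Ms] has the shape in
    which the induction hypothesis delivers it. *)
Lemma ground_flex_rigid {atom const} (Sg : signature atom const) Psi E Phi h As a
    Hs Phis Us Ns :
  gvar Psi E Phi (Atom a) -> is_head Sg Psi h (arr1 As a) ->
  flex_args Psi Hs Phis As Us -> proviso h Phi Phis ->
  forall Ms, grounds Sg Psi Ms Us As /\ grounds Sg Psi Ms Ns As ->
  ground Sg Psi (app1 h Ms) (eapp E Phi) (Atom a) /\
  ground Sg Psi (app1 h Ms) (app1 h Ns) (Atom a).
Proof.
  intros Hg Hh HF HP Ms [HU HN]. split; [|eapply ground_rigid; eassumption].
  destruct (grounds_flex_args_inv _ _ _ _ _ _ HF _ HU) as [HW HR].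
  apply ground_eapp. exists a. split; [reflexivity|]. split; [exact Hg|]. split.
  - apply wt_app1. exists As. split; [|exact HW].
    apply is_head_wt; [eapply is_head_rigid|]; eassumption.
  - eapply proviso_respects; eassumption.
Qed.

(** A head has only one type, so the argument types found by inversion are those fixed by the
    intersection rule. *)
Lemma ground_app1_inv_at {atom const} (Sg : signature atom const) Psi M h Ns As a :
  is_head Sg Psi h (arr1 As a) -> ground Sg Psi M (app1 h Ns) (Atom a) ->
  exists Ms, M = app1 h Ms /\ grounds Sg Psi Ms Ns As.
Proof.
  intros Hh HG. destruct (ground_app1_inv Sg Psi M h Ns (Atom a)) as
    (As' & a' & Ms & _ & -> & Hh' & HGs); [eapply is_head_rigid; eassumption|exact HG|].
  destruct (arr1_inj _ _ _ _ (is_head_fun _ _ _ _ _ Hh Hh')) as [-> _]. eauto.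
Qed.

(** Mutual induction on the derivation. For two flexible patterns the intersected labels imply those
    of each side; in the flexible-rigid cases the proviso turns conditions on the arguments into
    conditions on the whole term. *)
Lemma inter_sound {atom const} (Sg : signature atom const) :
  (forall Psi N1 N2 Q A F, inter Sg Psi N1 N2 Q A F ->
     forall M, ground Sg Psi M Q A -> ground Sg Psi M N1 A /\ ground Sg Psi M N2 A) /\
  (forall Psi Ns1 Ns2 Qs As F, inters Sg Psi Ns1 Ns2 Qs As F ->
     forall Ms, grounds Sg Psi Ms Qs As ->
     grounds Sg Psi Ms Ns1 As /\ grounds Sg Psi Ms Ns2 As).
Proof.
  apply inter_inters_ind.
  - intros Psi E1 Phi1 E2 Phi2 H Phi a _ Hg1 Hg2 Hcap _ M HG.
    apply ground_eapp in HG as (a' & [= <-] & _ & Hw & HR).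
    destruct (cap_lseq_respects _ _ _ _ Hcap HR).
    split; apply ground_eapp; exists a; auto.
  - intros Psi E Phi c As a Hs Phis Us Ms Ns F Hg Hc HF HP _ IH M HG.
    pose proof (head_const Sg Psi c Hc) as Hh.
    destruct (ground_app1_inv_at _ _ _ _ _ _ _ Hh HG) as (Ms0 & -> & HGs).
    eapply ground_flex_rigid; eauto.
  - intros Psi E Phi y As a Hs Phis Us Ms Ns F Hg Hc HF HP _ IH M HG.
    pose proof (head_var Sg Psi y Hc) as Hh.
    destruct (ground_app1_inv_at _ _ _ _ _ _ _ Hh HG) as (Ms0 & -> & HGs).
    eapply ground_flex_rigid; eauto.
  - intros Psi E Phi c As a Hs Phis Us Ms Ns F Hg Hc HF HP _ IH M HG.
    pose proof (head_const Sg Psi c Hc) as Hh.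
    destruct (ground_app1_inv_at _ _ _ _ _ _ _ Hh HG) as (Ms0 & -> & HGs).
    apply and_comm. eapply ground_flex_rigid; eauto. apply and_comm. auto.
  - intros Psi E Phi y As a Hs Phis Us Ms Ns F Hg Hc HF HP _ IH M HG.
    pose proof (head_var Sg Psi y Hc) as Hh.
    destruct (ground_app1_inv_at _ _ _ _ _ _ _ Hh HG) as (Ms0 & -> & HGs).
    apply and_comm. eapply ground_flex_rigid; eauto. apply and_comm. auto.
  - intros Psi h As a Ms Ns Qs F Hh _ IH M HG.
    destruct (ground_app1_inv_at _ _ _ _ _ _ _ Hh HG) as (Ms0 & -> & HGs).
    destruct (IH _ HGs). split; eapply ground_rigid; eassumption.
  - intros Psi A B M N Q F _ IH M0 HG.
    apply ground_lam_inv in HG as (B' & M' & _ & [= <-] & -> & HG).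
    destruct (IH _ HG). split; apply ground_lam; assumption.
  - intros Psi Ms HG. inversion HG; subst. split; constructor.
  - intros Psi N1 Ns1 N2 Ns2 Q Qs A As F Fs _ IH _ IHs Ms HG.
    inversion HG; subst.
    destruct (IH _ ltac:(eassumption)). destruct (IHs _ ltac:(eassumption)).
    split; constructor; assumption.
Qed.

(** * Completeness of intersection *)

(** Lets completeness treat flexible-rigid pairs with the flexible side on the left only. The rules
    come in mirrored pairs, and [cap_label] is commutative. *)
Lemma inter_sym {atom const} (Sg : signature atom const) :
  (forall Psi N1 N2 Q A F, inter Sg Psi N1 N2 Q A F -> inter Sg Psi N2 N1 Q A F) /\
  (forall Psi Ns1 Ns2 Qs As F, inters Sg Psi Ns1 Ns2 Qs As F ->
     inters Sg Psi Ns2 Ns1 Qs As F).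
Proof.
  apply inter_inters_ind; intros; try (econstructor; eassumption).
  eapply inter_FF; eauto.
  match goal with H : cap_lseq _ _ _ |- _ => destruct H as (L1 & L2 & HC) end.
  repeat split; auto. intros x k1 k2 Hk1 Hk2. rewrite <- (HC x k2 k1 Hk2 Hk1).
  destruct k1, k2; reflexivity.
Qed.

Lemma inter_FR {atom const} (Sg : signature atom const) Psi E Phi h As a Hs Phis Us
    Ms Ns F :
  gvar Psi E Phi (Atom a) -> is_head Sg Psi h (arr1 As a) ->
  flex_args Psi Hs Phis As Us -> proviso h Phi Phis ->
  inters Sg Psi Us Ms Ns As F ->
  inter Sg Psi (eapp E Phi) (app1 h Ms) (app1 h Ns) (Atom a) (Hs ++ F).
Proof.
  intros Hg Hh HF HP HI. inversion Hh; subst;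
    [eapply inter_FRc|eapply inter_FRy]; eassumption.
Qed.

(** * Supply of fresh existential variables *)

Definition names_in {atom} (n m : nat) (F : list (evar atom)) : Prop :=
  forall H, In H F -> n <= ename H < m.

Definition disjoint_evars {atom} (F G : list (evar atom)) : Prop :=
  forall H, In H F -> ~ In H G.

Lemma NoDup_names_app {atom} n m p (F G : list (evar atom)) :
  names_in n m F -> names_in m p G -> NoDup F -> NoDup G -> NoDup (F ++ G).
Proof.
  intros HF HG DF DG. apply NoDup_app; auto.
  intros H H1 H2. specialize (HF H H1). specialize (HG H H2). lia.
Qed.

Lemma names_in_app {atom} n m (F G : list (evar atom)) :
  names_in n m (F ++ G) <-> names_in n m F /\ names_in n m G.
Proof.
  unfold names_in. split.
  - intros H. split; intros E HE; apply H; apply in_or_app; auto.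
  - intros [H1 H2] E HE. apply in_app_or in HE as []; auto.
Qed.

Lemma names_in_weaken {atom} n m n' m' (F : list (evar atom)) :
  n' <= n -> m <= m' -> names_in n m F -> names_in n' m' F.
Proof. intros ? ? HF H HH. specialize (HF H HH). lia. Qed.

Lemma names_in_disjoint {atom} n m p (F G : list (evar atom)) :
  names_in n m F -> names_in m p G -> disjoint_evars F G.
Proof. intros HF HG H H1 H2. specialize (HF H H1). specialize (HG H H2). lia. Qed.

Lemma names_in_exists {atom} (F : list (evar atom)) : exists n, names_in 0 n F.
Proof.
  induction F as [|E F [n IH]].
  - exists 0. intros H [].
  - exists (S (ename E + n)). intros H [->|HH]; [lia|]. specialize (IH H HH). lia.
Qed.

Lemma flex_args_exist {atom const} (Psi : ctx atom) (As : list (ty atom)) :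
  forall n Phis, length Phis = length As ->
  Forall (fun Phi : lseq => length Phi = length Psi) Phis ->
  exists Hs (Us : list (tm atom const)), flex_args Psi Hs Phis As Us /\
    NoDup Hs /\ names_in n (n + length As) Hs.
Proof.
  induction As as [|A As IH]; intros n [|Phi Phis] HL HF; try discriminate.
  - exists [], []. split; [constructor|]. split; [constructor|]. intros H [].
  - inversion HF; subst.
    destruct (IH (S n) Phis) as (Hs & Us & H3 & H4 & H5); [simpl in HL; congruence|assumption|].
    (* The type carried by the new variable is chosen to make [gvar] hold by reflexivity; the names
       run upwards from [n]. *)
    exists (Evar n (arrs Psi Phi A) :: Hs), (eta_eapp (Evar n (arrs Psi Phi A)) Phi A :: Us).
    split; [|split].
    + constructor; [split; [assumption|reflexivity]|exact H3].
    + constructor; [|exact H4]. intros Hin. specialize (H5 _ Hin). simpl in H5. lia.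
    + intros H [<-|HH]; simpl; [lia|]. specialize (H5 H HH). lia.
Qed.

Lemma evars_flex_args {atom const} (Psi : ctx atom) Hs Phis As
    (Us : list (tm atom const)) :
  flex_args Psi Hs Phis As Us -> flat_map evars Us = Hs.
Proof. induction 1; simpl; [reflexivity|]. rewrite evars_eta_eapp. simpl. congruence. Qed.

(** The instances of [Ns] supply the eta-long shape of [Ms] that the patterns [Us] demand. *)
Lemma grounds_flex_args {atom const} (Sg : signature atom const) Psi Hs Phis As Us :
  flex_args Psi Hs Phis As Us -> forall Ms Ns, grounds Sg Psi Ms Ns As ->
  Forall2 (wt Sg Psi) Ms As -> Forall2 respects_seq Phis Ms ->
  grounds Sg Psi Ms Us As.
Proof.
  induction 1 as [|H Phi A Hs Phis As Us Hg HF IH]; intros Ms Ns HG HW HR;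
    inversion HG; subst; [constructor|].
  inversion HW; subst. inversion HR; subst.
  constructor; [eapply ground_eta_eapp|eapply IH]; eassumption.
Qed.

(** The derivation draws its new variables from the names in the interval from [n] up to [m];
    returning [m] lets the next derivation start there, so that separate parts share no variable. *)
Definition has_fresh_inter {atom const} (Sg : signature atom const) (n : nat)
    Psi M N1 N2 A : Prop :=
  exists Q F m, n <= m /\ inter Sg Psi N1 N2 Q A F /\ NoDup F /\ names_in n m F /\
    ground Sg Psi M Q A.

Definition inter_complete_at {atom const} (Sg : signature atom const) M : Prop :=
  forall n Psi N1 N2 A, ground Sg Psi M N1 A -> ground Sg Psi M N2 A ->
  names_in 0 n (evars N1) -> names_in 0 n (evars N2) ->
  disjoint_evars (evars N1) (evars N2) -> has_fresh_inter Sg n Psi M N1 N2 A.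

(** The bound is threaded through the arguments from left to right, so the new variables of
    different arguments have names in disjoint intervals. *)
Lemma inters_complete {atom const} (Sg : signature atom const) Ms :
  Forall (inter_complete_at Sg) Ms ->
  forall n Psi Ns1 Ns2 As, grounds Sg Psi Ms Ns1 As -> grounds Sg Psi Ms Ns2 As ->
  names_in 0 n (flat_map evars Ns1) -> names_in 0 n (flat_map evars Ns2) ->
  disjoint_evars (flat_map evars Ns1) (flat_map evars Ns2) ->
  exists Qs F m, n <= m /\ inters Sg Psi Ns1 Ns2 Qs As F /\ NoDup F /\ names_in n m F /\
    grounds Sg Psi Ms Qs As.
Proof.
  induction 1 as [|M Ms HM _ IH]; intros n Psi Ns1 Ns2 As HG1 HG2 B1 B2 HD.
  - inversion HG1; subst. inversion HG2; subst.
    exists [], [], n. split; [lia|]. split; [constructor|]. split; [constructor|].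
    split; [intros H []|constructor].
  - inversion HG1 as [|? ? ? N1 Ns1' A As' G1 Gs1]; subst.
    inversion HG2 as [|? ? ? N2 Ns2' ? ? G2 Gs2]; subst.
    simpl in *. apply names_in_app in B1 as [B1 Bs1]. apply names_in_app in B2 as [B2 Bs2].
    destruct (HM n Psi N1 N2 A) as (Q & F & m & Hnm & HI & HN & HF & HQ); auto.
    { intros H h1 h2. apply (HD H); apply in_or_app; auto. }
    destruct (IH m Psi Ns1' Ns2' As') as (Qs & Fs & p & Hmp & HIs & HNs & HFs & HQs); auto.
    { eapply names_in_weaken; [| |exact Bs1]; lia. }
    { eapply names_in_weaken; [| |exact Bs2]; lia. }
    { intros H h1 h2. apply (HD H); apply in_or_app; auto. }
    exists (Q :: Qs), (F ++ Fs), p. split; [lia|].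
    split; [constructor; assumption|].
    split; [eapply NoDup_names_app; eassumption|].
    split; [|constructor; assumption].
    apply names_in_app. split; [eapply (names_in_weaken n m)|eapply (names_in_weaken m p)]; eauto; lia.
Qed.

(** The label conditions on the ground term are distributed over its arguments by [proviso_exists].
    The resulting [Us] have the arguments [Ms] as instances, just as [Ns] do, so completeness for
    the arguments applies. *)
Lemma flex_rigid_complete {atom const} (Sg : signature atom const) n Psi h Ms E Phi Ns
    As a :
  Forall (inter_complete_at Sg) Ms -> is_head Sg Psi h (arr1 As a) ->
  gvar Psi E Phi (Atom a) -> wt Sg Psi (app1 h Ms) (Atom a) ->
  respects_seq Phi (app1 h Ms) -> grounds Sg Psi Ms Ns As ->
  names_in 0 n (flat_map evars Ns) ->
  has_fresh_inter Sg n Psi (app1 h Ms) (eapp E Phi) (app1 h Ns) (Atom a).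
Proof.
  intros IH Hh Hg Hw HR HG HB.
  assert (Hr : rigid_head h) by (eapply is_head_rigid; eassumption).
  assert (HW : Forall2 (wt Sg Psi) Ms As).
  { apply wt_app1 in Hw as (As' & Hh' & HW). apply is_head_wt in Hh'; [|exact Hr].
    destruct (arr1_inj _ _ _ _ (is_head_fun _ _ _ _ _ Hh Hh')) as [-> _]. exact HW. }
  destruct (proviso_exists _ _ _ Hr HR) as (Phis & HL & HRs & HP).
  destruct (@flex_args_exist atom const Psi As n Phis) as (Hs & Us & HF & HN & HHs).
  { rewrite (Forall2_length HRs). exact (Forall2_length HW). }
  { replace (length Psi) with (length Phi) by apply Hg. exact HL. }
  pose proof (grounds_flex_args Sg _ _ _ _ _ HF _ _ HG HW HRs) as HU.
  pose proof (evars_flex_args _ _ _ _ _ HF) as HE.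
  (* The names from [n] up to [n + length As] are taken by the variables [Hs]. *)
  destruct (inters_complete Sg Ms IH (n + length As) Psi Us Ns As)
    as (Qs & F & m & Hm & HI & HNF & HFs & HQs); auto.
  - rewrite HE. eapply names_in_weaken; [| |exact HHs]; lia.
  - eapply names_in_weaken; [| |exact HB]; lia.
  - rewrite HE. intros H h1 h2. exact (names_in_disjoint _ _ _ _ _ HB HHs H h2 h1).
  - exists (app1 h Qs), (Hs ++ F), m. split; [lia|].
    split; [eapply inter_FR; eassumption|].
    split; [eapply NoDup_names_app; eassumption|].
    split; [|eapply ground_rigid; eassumption].
    apply names_in_app. split; [eapply (names_in_weaken n (n + length As))|eapply (names_in_weaken (n + length As) m)]; eauto; lia.
Qed.

Lemma has_fresh_inter_sym {atom const} (Sg : signature atom const) n Psi M N1 N2 A :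
  has_fresh_inter Sg n Psi M N1 N2 A -> has_fresh_inter Sg n Psi M N2 N1 A.
Proof.
  intros (Q & F & m & Hm & HI & HR). exists Q, F, m.
  split; [exact Hm|]. split; [apply inter_sym; exact HI|exact HR].
Qed.

(** Induction on the size of [M], then a case analysis on how [M] is an instance of each pattern.
    The mixed cases reduce to [flex_rigid_complete], the equal ones to a label intersection or to
    the subterms. *)
Lemma inter_complete {atom const} (Sg : signature atom const) M :
  inter_complete_at Sg M.
Proof.
  induction M as [M IH] using (induction_ltof1 _ tm_size). unfold ltof in IH.
  assert (IHs : forall h Ms, M = app1 h Ms -> Forall (inter_complete_at Sg) Ms).
  { intros h Ms ->. destruct (tm_size_app1 Ms h) as [_ HF].
    eapply Forall_impl; [|exact HF]. auto. }
  intros n Psi N1 N2 A HG1 HG2 B1 B2 HD.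
  destruct HG1 as [Psi Z M E1 Phi1 a Hg1 Hok Ht|Psi A B M N1 HG1|Psi h As a Ms Ns1 Hh HG1].
  - assert (H1 : ground Sg Psi M (eapp E1 Phi1) (Atom a)) by (eapply ground_flex; eassumption).
    apply ground_eapp in H1 as (a' & [= <-] & _ & Hw & HR1). clear Z Hok Ht.
    (* Keeping the type as an equation discards the abstraction case, whose type is an arrow. *)
    remember (Atom a) as A eqn:EA.
    destruct HG2 as [Psi Z M E2 Phi2 a2 Hg2 Hok Ht|? ? ? ? ? _|Psi h As a2 Ms Ns2 Hh HG2];
      [|discriminate|]; injection EA as ->.
    + assert (H2 : ground Sg Psi M (eapp E2 Phi2) (Atom a)) by (eapply ground_flex; eassumption).
      apply ground_eapp in H2 as (a' & [= <-] & _ & _ & HR2).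
      destruct (cap_lseq_exists M Phi1 Phi2) as (Phi & Hcap & HR); auto.
      { transitivity (length Psi); [apply Hg1|symmetry; apply Hg2]. }
      assert (HgH : gvar Psi (Evar n (arrs Psi Phi (Atom a))) Phi (Atom a)).
      { split; [|reflexivity]. destruct Hcap as [<- _]. apply Hg1. }
      exists (eapp (Evar n (arrs Psi Phi (Atom a))) Phi), [Evar n (arrs Psi Phi (Atom a))], (S n).
      split; [lia|]. split.
      (* Were the two existential variables equal, the patterns would share one, against [HD]. *)
      { eapply inter_FF; eauto. intros ->. apply (HD E2); rewrite evars_eapp; left; auto. }
      split; [repeat constructor; intros []|].
      split; [intros H [<-|[]]; simpl; lia|].
      apply ground_eapp. exists a. auto.
    + rewrite evars_app1, (evars_rigid h (is_head_rigid _ _ _ _ Hh)) in B2.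
      eapply flex_rigid_complete; eauto.
  - inversion HG2 as [|? ? ? ? N2' HG2'|]; subst.
    destruct (IH M (Nat.lt_succ_diag_r _) n (A :: Psi) N1 N2' B) as
      (Q & F & m & Hm & HI & HN & HF & HQ); auto.
    exists (Lam lu A Q), F, m. split; [lia|].
    split; [constructor; exact HI|]. split; [exact HN|]. split; [exact HF|].
    constructor; exact HQ.
  - assert (Hr : rigid_head h) by (eapply is_head_rigid; eassumption).
    rewrite evars_app1, (evars_rigid h Hr) in B1, HD. simpl in B1, HD.
    remember (Atom a) as A eqn:EA. remember (app1 h Ms) as M eqn:EM.
    destruct HG2 as [Psi Z M E2 Phi2 a2 Hg2 Hok Ht|? ? ? ? ? _|Psi h' As' a2 Ms' Ns2 Hh' HG2];
      [|discriminate|]; injection EA as ->.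
    + assert (H2 : ground Sg Psi M (eapp E2 Phi2) (Atom a)) by (eapply ground_flex; eassumption).
      apply ground_eapp in H2 as (a' & [= <-] & _ & Hw & HR2). subst M.
      apply has_fresh_inter_sym. eapply flex_rigid_complete; eauto.
    + apply app1_inj in EM as [-> ->]; [|eapply is_head_rigid; eassumption|exact Hr].
      destruct (arr1_inj _ _ _ _ (is_head_fun _ _ _ _ _ Hh Hh')) as [-> _].
      rewrite evars_app1, (evars_rigid h Hr) in B2, HD. simpl in B2, HD.
      destruct (inters_complete Sg Ms (IHs h Ms eq_refl) n Psi Ns1 Ns2 As')
        as (Qs & F & m & Hm & HI & HN & HF & HQs); auto.
      exists (app1 h Qs), F, m. split; [exact Hm|].
      split; [eapply inter_RR; eassumption|]. split; [exact HN|]. split; [exact HF|].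
      eapply ground_rigid; eassumption.
Qed.

Theorem theorem7p8 (atom const : Type) (Sg : signature atom const) (hSg : pos_signature Sg)
    (Psi : ctx atom) (hPsi : forall B, In B Psi -> pos B)
    (N1 N2 : tm atom const) (A : ty atom)
    (hlin1 : linear N1) (hlin2 : linear N2)
    (hsep : forall E, In E (evars N1) -> ~ In E (evars N2))
    (hN1 : pat Sg Psi N1 A) (hN2 : pat Sg Psi N2 A)
    (M : tm atom const) (hM : closed M) :
  (ground Sg Psi M N1 A /\ ground Sg Psi M N2 A) <->
  ground_set Sg Psi M (cap Sg Psi N1 N2 A) A.
Proof.
  split.
  - intros [H1 H2].
    (* Starting the supply above every name in both patterns makes all variables of the derivation
       fresh for them. *)
    destruct (names_in_exists (evars N1 ++ evars N2)) as [n Hn].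
    apply names_in_app in Hn as [Hn1 Hn2].
    destruct (inter_complete Sg M n Psi N1 N2 A H1 H2 Hn1 Hn2 hsep)
      as (Q & F & m & _ & HI & HN & HF & HQ).
    exists Q. split; [|exact HQ]. exists F. split; [exact HI|]. split; [exact HN|].
    intros H HH. split; intros Hin.
    + exact (names_in_disjoint _ _ _ _ _ Hn1 HF H Hin HH).
    + exact (names_in_disjoint _ _ _ _ _ Hn2 HF H Hin HH).
  - intros (Q & (F & HI & _) & HQ).
    destruct (inter_sound Sg) as [HS _]. eapply HS; eassumption.
Qed.
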